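(* Let $J:C[0,1]\rightrightarrows rca[0,1]$ be the normalized duality mapping of the real Banach space $C[0,1]$. Let $f\in C^+[0,1]$ with $\|f\|>0$, and let $f^{**}\in rca^*[0,1]$ be the functional induced by $f$. Then, for any $\mu\in J(f)$, we have $$\theta^*\notin\widehat{D}^*J(f,\mu)(f^{**}).$$
   Context: $C[0,1]$ is the Banach space of continuous real functions on $[0,1]$ with the maximum norm $\|\cdot\|$; its dual $C^*[0,1]=rca[0,1]$ is the space of regular countably additive real-valued measures on the Borel $\sigma$-field $\Sigma$ of $[0,1]$, with pairing $\langle\mu,f\rangle=\int_0^1 f(s)\,\mu(ds)$ and norm $\|\mu\|_*=v(\mu,[0,1])$, the total variation of $\mu$ (the dual norm). $rca^*[0,1]=C^{**}[0,1]$ is the dual of $rca[0,1]$, with pairing $\langle\cdot,\cdot\rangle_*$. $\theta^*$ is the zero of $rca[0,1]$. $C^+[0,1]=\{f\in C[0,1]: f(s)\ge0\ \forall s\in[0,1]\}$. Each $f\in C^+[0,1]$ induces $f^{**}\in rca^*[0,1]$ by $\langle f^{**},\gamma\rangle_*=\langle\gamma,f\rangle$ for all $\gamma\in rca[0,1]$. The normalized duality mapping is $J(f)=\{\mu\in rca[0,1]:\langle\mu,f\rangle=\|f\|^2=\|\mu\|_*^2\}$. For $\mu\in J(f)$, the Mordukhovich derivative of $J$ at $(f,\mu)$ is defined, for $\Phi\in C^{**}[0,1]$, by $$\widehat{D}^*J(f,\mu)(\Phi)=\left\{\lambda\in rca[0,1]:\ \limsup_{(g,\gamma)\to(f,\mu),\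 g\in C[0,1],\ \gamma\in J(g)}\frac{\langle\lambda,g-f\rangle-\langle\Phi,\gamma-\mu\rangle_*}{\|g-f\|+\|\gamma-\mu\|_*}\le0\right\},$$ with convergence in the norms and $(g,\gamma)\neq(f,\mu)$. *)

(* Defs.v *)
From HB Require Import structures.
From mathcomp Require Import all_boot all_order all_algebra.
From mathcomp Require Import all_classical all_reals all_analysis.
From mathcomp Require Import measurable_realfun.
From mathcomp Require Import lra.

Set Implicit Arguments.
Unset Strict Implicit.
Unset Printing Implicit Defensive.

Import Order.TTheory GRing.Theory Num.Theory.
Import numFieldNormedType.Exports.
Import numFieldTopology.Exports.

Local Open Scope classical_set_scope.
Local Open Scope ring_scope.

Section charge_integral.
Context d (T : measurableType d) (R : realType).
Implicit Types (nu : {charge set T -> \bar R}) (m : {measure set T -> \bar R}).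
Implicit Types f : T -> R.

Definition hahn_pos nu : set T := projT1 (cid (Hahn_decomposition nu)).

Definition hahn_neg nu : set T :=
  projT1 (cid (projT2 (cid (Hahn_decomposition nu)))).

Lemma hahnP nu : hahn_decomposition nu (hahn_pos nu) (hahn_neg nu).
Proof. exact: projT2 (cid (projT2 (cid (Hahn_decomposition nu)))). Qed.

(* The value does not depend on the chosen Hahn decomposition
   (see [charge_integralE]). *)
Definition charge_integral nu f : R :=
  \int[jordan_pos (hahnP nu)]_x f x - \int[jordan_neg (hahnP nu)]_x f x.

Definition total_variation nu : R :=
  fine (charge_variation (hahnP nu) setT).

Definition bounded_measurable f :=
  measurable_fun setT f /\ exists M : R, forall x, `|f x| <= M.

Lemma bounded_measurable_integrable m f : (m setT < +oo)%E ->
  bounded_measurable f -> m.-integrable setT (EFin \o f).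
Proof.
move=> moo [mf [M fM]]; apply: measurable_bounded_integrable => //.
exists M; split; first exact: num_real.
by move=> N MN x _; exact: le_trans (fM x) (ltW MN).
Qed.

Lemma Rintegral_measure_add m1 m2 f : (m1 setT < +oo)%E -> (m2 setT < +oo)%E ->
  bounded_measurable f ->
  \int[measure_add m1 m2]_x f x = \int[m1]_x f x + \int[m2]_x f x.
Proof.
move=> h1 h2 bf; have i1 := bounded_measurable_integrable h1 bf.
have i2 := bounded_measurable_integrable h2 bf.
by rewrite /Rintegral integral_measure_add// fineD// integrable_fin_num.
Qed.

Lemma Rintegral_mscale (k : {nonneg R}) m f : (m setT < +oo)%E ->
  bounded_measurable f ->
  \int[mscale k m]_x f x = k%:num * \int[m]_x f x.
Proof.
move=> moo bf; have im := bounded_measurable_integrable moo bf.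
have ip := integrable_funepos measurableT im.
have ineg := integrable_funeneg measurableT im.
have mp := measurable_int _ ip; have mn := measurable_int _ ineg.
rewrite /Rintegral integralE [in RHS]integralE !ge0_integral_mscale//.
have := integrable_fin_num measurableT ip.
have := integrable_fin_num measurableT ineg.
move=> /fineK <- /fineK <-.
by rewrite -!EFinM -!EFinN -!EFinD/=; lra.
Qed.

Lemma measure_add_sortE m1 m2 A :
  (measure_add m1 m2 : {measure set T -> \bar R}) A = (m1 A + m2 A)%E.
Proof. exact: measure_addE. Qed.

Lemma jordan_pos_lty nu : (jordan_pos (hahnP nu) setT < +oo)%E.
Proof. by rewrite ltey_eq fin_num_measure. Qed.

Lemma jordan_neg_lty nu : (jordan_neg (hahnP nu) setT < +oo)%E.
Proof. by rewrite ltey_eq fin_num_measure. Qed.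

Lemma charge_integralE nu m1 m2 f : (m1 setT < +oo)%E -> (m2 setT < +oo)%E ->
  (forall A, measurable A -> nu A = m1 A - m2 A)%E ->
  bounded_measurable f ->
  charge_integral nu f = \int[m1]_x f x - \int[m2]_x f x.
Proof.
move=> h1 h2 num12 bf.
have fin1 A : measurable A -> m1 A \is a fin_num.
  move=> mA; rewrite ge0_fin_numE//; apply: le_lt_trans h1.
  by apply: le_measure; rewrite ?inE.
have fin2 A : measurable A -> m2 A \is a fin_num.
  move=> mA; rewrite ge0_fin_numE//; apply: le_lt_trans h2.
  by apply: le_measure; rewrite ?inE.
set p := jordan_pos (hahnP nu); set n := jordan_neg (hahnP nu).
have : \int[measure_add p m2]_x f x = \int[measure_add m1 n]_x f x.
  rewrite /Rintegral; congr fine; apply: eq_measure_integral => A mA _.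
  rewrite !measure_add_sortE.
  have := jordan_decomp (hahnP nu) mA.
  rewrite num12// /cadd/= /cscale/= -/p -/n mulN1e.
  have := fin1 _ mA; have := fin2 _ mA.
  have : p A \is a fin_num by exact: fin_num_measure.
  have : n A \is a fin_num by exact: fin_num_measure.
  move=> /fineK <- /fineK <- /fineK <- /fineK <-.
  rewrite -!EFinN -!EFinD => -[e]; congr EFin; lra.
rewrite !Rintegral_measure_add//; first by rewrite /charge_integral -/p -/n; lra.
- exact: jordan_neg_lty.
- exact: jordan_pos_lty.
Qed.

Lemma charge_integral_cadd nu1 nu2 f : bounded_measurable f ->
  charge_integral (cadd nu1 nu2) f =
  charge_integral nu1 f + charge_integral nu2 f.
Proof.
move=> bf.
have := jordan_pos_lty nu1; have := jordan_neg_lty nu1.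
have := jordan_pos_lty nu2; have := jordan_neg_lty nu2 => n2 p2 n1 p1.
rewrite (@charge_integralE _ (measure_add (jordan_pos (hahnP nu1))
  (jordan_pos (hahnP nu2))) (measure_add (jordan_neg (hahnP nu1))
  (jordan_neg (hahnP nu2))))//.
- by rewrite !Rintegral_measure_add// /charge_integral; lra.
- by rewrite measure_add_sortE lte_add_pinfty.
- by rewrite measure_add_sortE lte_add_pinfty.
- move=> A mA; rewrite !measure_add_sortE.
  transitivity (nu1 A + nu2 A)%E; first by [].
  rewrite (jordan_decomp (hahnP nu1) mA) (jordan_decomp (hahnP nu2) mA).
  rewrite /cadd/= /cscale/= !mulN1e.
  rewrite fin_num_oppeD ?fin_num_measure//.
  by rewrite addeACA.
Qed.

Lemma charge_integral_cscale (r : R) nu f : bounded_measurable f ->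
  charge_integral (cscale r nu) f = r * charge_integral nu f.
Proof.
move=> bf.
have := jordan_pos_lty nu; have := jordan_neg_lty nu => hn hp.
have fin m : (m setT < +oo)%E -> forall k : {nonneg R},
    (mscale k m setT < +oo)%E.
  by move=> moo k; rewrite /mscale/= lte_mul_pinfty.
have hA A (mA : measurable A) :
    ((cscale r nu : {charge set T -> \bar R}) A = r%:E * (jordan_pos (hahnP nu) A - jordan_neg (hahnP nu) A))%E.
  transitivity (r%:E * nu A)%E; first by [].
  by rewrite (jordan_decomp (hahnP nu) mA) /cadd/= /cscale/= mulN1e.
have [r0|r0] := leP 0 r.
- pose k := NngNum r0.
  rewrite (@charge_integralE _ (mscale k (jordan_pos (hahnP nu)))
    (mscale k (jordan_neg (hahnP nu))))//; [|exact: fin|exact: fin|].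
  + by rewrite !Rintegral_mscale//= /charge_integral; lra.
  + move=> A mA; rewrite hA// /mscale/= muleBr//.
    by rewrite fin_num_adde_defr// fin_num_measure.
- have Nr0 : 0 <= - r by lra.
  pose k := NngNum Nr0.
  rewrite (@charge_integralE _ (mscale k (jordan_neg (hahnP nu)))
    (mscale k (jordan_pos (hahnP nu))))//; [|exact: fin|exact: fin|].
  + by rewrite !Rintegral_mscale//= /charge_integral; lra.
  + move=> A mA; rewrite hA//.
    transitivity ((- r)%:E * jordan_neg (hahnP nu) A -
                  (- r)%:E * jordan_pos (hahnP nu) A)%E; last by [].
    have : jordan_pos (hahnP nu) A \is a fin_num by exact: fin_num_measure.
    have : jordan_neg (hahnP nu) A \is a fin_num by exact: fin_num_measure.
    move=> /fineK <- /fineK <-.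
    by rewrite -!(EFinM, EFinB); congr EFin; lra.
Qed.

Lemma total_variationE nu :
  total_variation nu = fine (jordan_pos (hahnP nu) setT) +
                       fine (jordan_neg (hahnP nu) setT).
Proof. by rewrite /total_variation /charge_variation/= fineD ?fin_num_measure. Qed.

Lemma normr_Rintegral_bounded m f (M : R) : (m setT < +oo)%E ->
  bounded_measurable f -> (forall x, `|f x| <= M) ->
  `|\int[m]_x f x| <= M * fine (m setT).
Proof.
move=> moo bf fM; have im := bounded_measurable_integrable moo bf.
apply: (le_trans (le_normr_Rintegral measurableT im)).
rewrite -Rintegral_cst//; apply: le_Rintegral => //.
- exact: (integrable_norm im).
- apply: bounded_measurable_integrable => //; split => //.
  by exists `|M|.
Qed.

Lemma normr_charge_integral nu f (M : R) : bounded_measurable f ->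
  (forall x, `|f x| <= M) ->
  `|charge_integral nu f| <= M * total_variation nu.
Proof.
move=> bf fM; rewrite /charge_integral total_variationE mulrDr.
apply: (le_trans (ler_normB _ _)); apply: lerD.
- exact: normr_Rintegral_bounded (jordan_pos_lty nu) bf fM.
- exact: normr_Rintegral_bounded (jordan_neg_lty nu) bf fM.
Qed.

Lemma total_variation_hahn nu :
  (total_variation nu)%:E = (nu (hahn_pos nu) - nu (hahn_neg nu))%E.
Proof.
have [[mP _] [mN _] _ _] := hahnP nu.
rewrite /total_variation fineK; last first.
  by rewrite /charge_variation fin_numD !fin_num_measure.
rewrite /charge_variation jordan_posE cjordan_posE jordan_negE cjordan_negE.
by rewrite /crestr0 mem_set//= /crestr !setTI.
Qed.

Lemma total_variation_ge nu A B : measurable A -> measurable B ->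
  A `&` B = set0 -> (`|nu A| + `|nu B| <= (total_variation nu)%:E)%E.
Proof.
move=> mA mB AB0; rewrite /total_variation fineK; last first.
  by rewrite /charge_variation fin_numD !fin_num_measure.
apply: (@le_trans _ _ (charge_variation (hahnP nu) A +
                       charge_variation (hahnP nu) B)%E).
  by apply: leeD; exact: abse_charge_variation.
rewrite -measureU//; apply: le_measure; rewrite ?inE//.
exact: measurableU.
Qed.

(* Agreement with the definition of the variation by finite disjoint families. *)
Lemma total_variation_sup nu : (total_variation nu)%:E =
  ereal_sup [set x | exists n (F : (set T)^nat),
    [/\ forall i, measurable (F i), trivIset setT F &
        x = (\sum_(i < n) `|nu (F i)|)%E]].
Proof.
apply/eqP; rewrite eq_le; apply/andP; split.
- have [[mP nuP] [mN nuN] _ PN0] := hahnP nu.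
  apply: ereal_sup_ubound; exists 2, (bigcup2 (hahn_pos nu) (hahn_neg nu)).
  split.
  + by case=> [|[|i]] /=.
  + by rewrite -trivIset_bigcup2.
  + rewrite !big_ord_recl big_ord0 adde0 /bigcup2/= total_variation_hahn.
    by rewrite gee0_abs ?nuP// lee0_abs ?nuN.
- apply: ge_ereal_sup => _ [n [F [mF tF ->]]].
  rewrite /total_variation fineK; last first.
    by rewrite /charge_variation fin_numD !fin_num_measure.
  apply: (@le_trans _ _ (\sum_(i < n) charge_variation (hahnP nu) (F i))%E).
    by apply: lee_sum => i _; exact: abse_charge_variation.
  rewrite -measure_bigsetU//.
  apply: le_measure; rewrite ?inE//.
  exact: bigsetU_measurable.
Qed.

Lemma total_variation_cadd nu1 nu2 :
  total_variation (cadd nu1 nu2) <= total_variation nu1 + total_variation nu2.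
Proof.
rewrite -lee_fin EFinD total_variation_hahn.
set P := hahn_pos _; set N := hahn_neg _.
have [[mP _] [mN _] _ PN0] := hahnP (cadd nu1 nu2).
have := total_variation_ge nu1 mP mN PN0.
have := total_variation_ge nu2 mP mN PN0.
rewrite -[X in _ -> _ -> (X <= _)%E]/((nu1 P + nu2 P) - (nu1 N + nu2 N))%E.
have fin nu A : measurable A -> nu A \is a fin_num by exact: fin_num_measure.
have := fin nu1 _ mP; have := fin nu1 _ mN.
have := fin nu2 _ mP; have := fin nu2 _ mN.
rewrite -/P -/N => /fineK <- /fineK <- /fineK <- /fineK <-.
rewrite /= -!(EFinD, EFinB) !lee_fin.
set a := fine _; set b := fine _; set c := fine _; set e := fine _.
move=> h2 h1.
have hb : - b <= `|b| by rewrite -normrN ler_norm.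
have he : - e <= `|e| by rewrite -normrN ler_norm.
have ha := ler_norm a; have hc := ler_norm c.
lra.
Qed.

Lemma total_variation_cscale_le (r : R) nu :
  total_variation (cscale r nu) <= `|r| * total_variation nu.
Proof.
rewrite -lee_fin total_variation_hahn.
set P := hahn_pos _; set N := hahn_neg _.
have [[mP _] [mN _] _ PN0] := hahnP (cscale r nu).
have := total_variation_ge nu mP mN PN0.
have fin A : measurable A -> nu A \is a fin_num by exact: fin_num_measure.
rewrite -[X in _ -> (X <= _)%E]/(r%:E * nu P - r%:E * nu N)%E.
have := fin _ mP; have := fin _ mN.
rewrite -/P -/N => /fineK <- /fineK <-.
rewrite /= -!(EFinM, EFinB, EFinD) !lee_fin.
set a := fine _; set b := fine _ => h.
apply: (@le_trans _ _ (`|r| * (`|a| + `|b|))); last exact: ler_wpM2l.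
rewrite mulrDr -!normrM; apply: lerD; first exact: ler_norm.
by rewrite -normrN; exact: ler_norm.
Qed.

Lemma total_variation_eq0 nu : total_variation nu = 0 ->
  forall A, measurable A -> nu A = 0%E.
Proof.
move=> nu0 A mA; have := total_variation_ge nu mA measurable0 (setI0 A).
rewrite nu0 charge0 abse0 adde0 => h.
by apply/eqP; rewrite -abse_eq0 eq_le h abse_ge0.
Qed.

Lemma eq_charge (nu1 nu2 : {charge set T -> \bar R}) :
  (nu1 : set T -> \bar R) = nu2 -> nu1 = nu2.
Proof.
case: nu1 => n1 [[a1] [b1] [c1]]; case: nu2 => n2 [[a2] [b2] [c2]] /= e.
rewrite e in a1 b1 c1 *.
by rewrite (Prop_irrelevance a1 a2) (Prop_irrelevance b1 b2)
           (Prop_irrelevance c1 c2).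
Qed.

End charge_integral.

Section unit_interval.
Variable R : realType.

Definition I01 : Type := set_type (`[0, 1]%classic : set R).

HB.instance Definition _ := Topological.copy I01 (set_type (`[0, 1]%classic : set R)).

Lemma I01_subproof (x : R) : Num.max 0 (Num.min x 1) \in (`[0, 1]%classic : set R).
Proof.
rewrite inE/= in_itv/= le_max lexx/= ge_max ler01/=.
by rewrite ge_min lexx orbT.
Qed.

Definition clamp (x : R) : I01 := exist _ (Num.max 0 (Num.min x 1)) (I01_subproof x).

Lemma clampK (s : I01) : clamp (\val s) = s.
Proof.
apply: val_inj => /=; case: s => x /=.
by rewrite inE/= in_itv/= => /andP[x0 x1]; rewrite min_l// max_r.
Qed.

Lemma continuous_clamp : continuous clamp.
Proof.
apply: continuous_comp_initial => x /=.
apply: (@continuous_max _ _ (cst (0 : R)) ((id : R -> R^o) \min cst (1 : R))).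
  exact: cvg_cst.
by apply: continuous_min; [exact: cvg_id | exact: cvg_cst].
Qed.

HB.instance Definition _ := isPointed.Build I01 (clamp 0).

HB.instance Definition _ :=
  Measurable.copy I01 (g_sigma_algebraType (@open I01)).

End unit_interval.

Section C01.
Variable R : realType.

Definition C01 : Type := continuousType (I01 R) R.

Identity Coercion C01_continuousType : C01 >-> continuousType.

HB.instance Definition _ := Choice.on C01.

Implicit Types f g : C01.

Definition C01_mk (f : I01 R -> R) (cf : continuous f) : C01 :=
  HB.pack_for (continuousType (I01 R) R) f (isContinuous.Build _ _ f cf).

Lemma C01_eqP f g : (forall s, f s = g s) -> f = g.
Proof. by move=> fg; apply/continuousEP. Qed.

Lemma C01_cts f : continuous f.
Proof. exact: cts_fun. Qed.

Fact C01_zero_subproof : continuous (fun _ : I01 R => 0 : R).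
Proof. by exact: cst_continuous. Qed.
Fact C01_opp_subproof f : continuous (fun s => - f s).
Proof. by move=> s; apply: (@continuousN _ _ (I01 R)); exact: (@C01_cts f s). Qed.
Fact C01_add_subproof f g : continuous (fun s => f s + g s).
Proof.
move=> s; apply: (@continuousD _ _ (I01 R)).
- exact: (@C01_cts f s).
- exact: (@C01_cts g s).
Qed.
Fact C01_scale_subproof (a : R) f : continuous (fun s => a * f s).
Proof.
move=> s; apply: (@continuousM _ (I01 R)); last exact: (@C01_cts f s).
exact: (@cst_continuous (I01 R) R a s).
Qed.

Definition C01_zero : C01 := C01_mk C01_zero_subproof.
Definition C01_opp f : C01 := C01_mk (@C01_opp_subproof f).
Definition C01_add f g : C01 := C01_mk (@C01_add_subproof f g).
Definition C01_scale (a : R) f : C01 := C01_mk (@C01_scale_subproof a f).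

Fact C01_addA : associative C01_add.
Proof. by move=> f g h; apply: C01_eqP => s; exact: addrA. Qed.
Fact C01_addC : commutative C01_add.
Proof. by move=> f g; apply: C01_eqP => s; exact: addrC. Qed.
Fact C01_add0 : left_id C01_zero C01_add.
Proof. by move=> f; apply: C01_eqP => s; exact: add0r. Qed.
Fact C01_addN : left_inverse C01_zero C01_opp C01_add.
Proof. by move=> f; apply: C01_eqP => s; exact: addNr. Qed.

HB.instance Definition _ :=
  GRing.isZmodule.Build C01 C01_addA C01_addC C01_add0 C01_addN.

Fact C01_scaleA (a b : R) f : C01_scale a (C01_scale b f) = C01_scale (a * b) f.
Proof. by apply: C01_eqP => s; exact: mulrA. Qed.
Fact C01_scale1 : left_id 1 C01_scale.
Proof. by move=> f; apply: C01_eqP => s; exact: mul1r. Qed.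
Fact C01_scaleDr : right_distributive C01_scale +%R.
Proof. by move=> a f g; apply: C01_eqP => s; exact: mulrDr. Qed.
Fact C01_scaleDl f : {morph C01_scale^~ f : a b / a + b}.
Proof. by move=> a b; apply: C01_eqP => s; exact: mulrDl. Qed.

HB.instance Definition _ := GRing.Zmodule_isLmodule.Build R C01
  C01_scaleA C01_scale1 C01_scaleDr C01_scaleDl.

Definition C01_norm f : R := sup (range (fun s => `|f s|)).

Fact C01_EVT f : exists t : I01 R, forall s : I01 R, `|f s| <= `|f t|.
Proof.
have [] := @EVT_max R (fun x => `|f (clamp x)|) 0 1 ler01.
  apply: continuous_subspaceT => x.
  apply: (@continuous_comp _ _ _ (fun y => f (clamp y)) Num.norm); last first.
    exact: norm_continuous.
  apply: (@continuous_comp _ _ _ (@clamp R) f).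
    exact: continuous_clamp.
  exact: cts_fun.
move=> c c01 fc; exists (clamp c) => s.
rewrite -[s in X in X <= _]clampK; apply: fc.
by case: s => x /=; rewrite inE.
Qed.

Lemma ler_C01_norm f (s : I01 R) : `|f s| <= C01_norm f.
Proof.
have [t ft] := C01_EVT f.
by apply: ub_le_sup; [exists `|f t| => _ [u _ <-] | exists s].
Qed.

Lemma C01_norm_le f (M : R) : (forall s : I01 R, `|f s| <= M) -> C01_norm f <= M.
Proof.
move=> fM; apply: ge_sup; first by exists `|f point|; exists point.
by move=> _ [s _ <-].
Qed.

Lemma C01_norm_max f : exists s : I01 R, C01_norm f = `|f s|.
Proof.
have [t ft] := C01_EVT f; exists t; apply/eqP; rewrite eq_le ler_C01_norm andbT.
exact: C01_norm_le.
Qed.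

Fact C01_ler_normD f g : C01_norm (f + g) <= C01_norm f + C01_norm g.
Proof.
apply: C01_norm_le => s; apply: (le_trans (ler_normD (f s) (g s))).
by apply: lerD; exact: ler_C01_norm.
Qed.

Fact C01_normZ (a : R) f : C01_norm (a *: f) = `|a| * C01_norm f.
Proof.
have [t ft] := C01_norm_max f; apply/eqP; rewrite eq_le; apply/andP; split.
  apply: C01_norm_le => s; rewrite -[X in X <= _]/(`|a * f s|) normrM.
  by apply: ler_wpM2l => //; exact: ler_C01_norm.
by rewrite ft -normrM; exact: (ler_C01_norm (a *: f)).
Qed.

Fact C01_norm0_eq0 f : C01_norm f = 0 -> f = 0.
Proof.
move=> f0; apply: C01_eqP => s; apply/eqP; rewrite -normr_le0 -f0.
exact: ler_C01_norm.
Qed.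

HB.instance Definition _ := Lmodule_isNormed.Build R C01
  C01_ler_normD C01_normZ C01_norm0_eq0.

Lemma C01_normE f : `|f| = sup (range (fun s => `|f s|)).
Proof. by []. Qed.

Lemma C01_bounded_measurable f : bounded_measurable (f : I01 R -> R).
Proof.
split; last by exists `|f| => s; exact: ler_C01_norm.
apply: (measurability _ (RGenOpens.measurableE R)).
move=> _ [_ [a [b ->] <-]]; rewrite setTI; apply: sub_sigma_algebra.
have /continuousP := @C01_cts f; apply; exact: interval_open.
Qed.

End C01.

Section rca.
Variable R : realType.

(* Regularity in the sense of Dunford and Schwartz (III.5.11); for finite charges
   on [0,1] it is automatic, but it is part of the definition of [rca]. *)
Definition regular_charge (nu : {charge set (I01 R) -> \bar R}) : Prop :=
  forall E : set (I01 R), measurable E -> forall e : R, 0 < e ->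
  exists F G : set (I01 R), [/\ closed F, open G, F `<=` E, E `<=` G &
    forall C, measurable C -> C `<=` G `\` F -> (`|nu C| < e%:E)%E].

(* A charge is a function on all sets, constrained on the measurable ones only.
   Requiring the value 0 elsewhere makes an element of [rca] determined by its
   values on the Borel sets, so that equality in [rca] is equality of measures. *)
Record rca := Rca {
  rca_charge :> {charge set (I01 R) -> \bar R} ;
  rca_regular : regular_charge rca_charge ;
  rca_nonmeasurable : forall A, ~ measurable A -> rca_charge A = 0%E }.

HB.instance Definition _ := gen_eqMixin rca.
HB.instance Definition _ := gen_choiceMixin rca.

Lemma rca_eqP (mu nu : rca) : (forall A, measurable A -> mu A = nu A) -> mu = nu.
Proof.
case: mu nu => [m rm nm] [n rn nn] /= mn.
have e : m = n.
  apply: eq_charge; apply/funext => A.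
  by have [/mn//|nA] := pselect (measurable A); rewrite nm ?nn.
rewrite e in rm nm *.
by rewrite (Prop_irrelevance rm rn) (Prop_irrelevance nm nn).
Qed.

Lemma rca_fin_num (mu : rca) A : mu A \is a fin_num.
Proof.
have [mA|nA] := pselect (measurable A); first exact: fin_num_measure.
by rewrite rca_nonmeasurable.
Qed.

Fact rca_zero_regular : regular_charge (@czero _ (I01 R) R).
Proof.
move=> E mE e e0; exists set0, setT; split => //.
- exact: closed0.
- exact: openT.
- by move=> C _ _; rewrite /czero abse0 lte_fin.
Qed.

Fact rca_add_regular (mu nu : rca) : regular_charge (cadd mu nu).
Proof.
move=> E mE e e0; have e20 : 0 < e / 2 by lra.
have [F1 [G1 [cF1 oG1 FE1 EG1 h1]]] := rca_regular mu mE e20.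
have [F2 [G2 [cF2 oG2 FE2 EG2 h2]]] := rca_regular nu mE e20.
exists (F1 `|` F2), (G1 `&` G2); split.
- exact: closedU.
- exact: openI.
- by move=> x [/FE1|/FE2].
- by move=> x Ex; split; [exact: EG1|exact: EG2].
- move=> C mC CGF.
  have k1 : (`|mu C| < (e / 2)%:E)%E.
    apply: h1 => //; apply: subset_trans CGF _ => x [[? _] n].
    by split => //; apply: contra_not n; left.
  have k2 : (`|nu C| < (e / 2)%:E)%E.
    apply: h2 => //; apply: subset_trans CGF _ => x [[_ ?] n].
    by split => //; apply: contra_not n; right.
  apply: (le_lt_trans (lee_abs_add _ _)).
  have -> : e%:E = ((e / 2)%:E + (e / 2)%:E)%E by rewrite -EFinD -splitr.
  exact: lteD k1 k2.
Qed.

Fact rca_scale_regular (a : R) (mu : rca) : regular_charge (cscale a mu).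
Proof.
move=> E mE e e0.
have a0 : 0 < `|a| + 1 by rewrite ltr_wpDl.
have [F [G [cF oG FE EG h]]] := rca_regular mu mE (divr_gt0 e0 a0).
exists F, G; split => // C mC /(h _ mC).
rewrite -[X in _ -> (X < _)%E]/(`|a%:E * mu C|)%E abseM.
have /fineK <- := rca_fin_num mu C.
rewrite -[X in (X < _)%E -> _]/(`|fine (mu C)|%:E).
rewrite -[X in _ -> (X < _)%E]/((`|a| * `|fine (mu C)|)%:E) !lte_fin.
rewrite ltr_pdivlMr// mulrC; apply: le_lt_trans.
by rewrite ler_wpM2r// lerDl.
Qed.

Definition rca_zero : rca.
Proof. by apply: (@Rca (@czero _ (I01 R) R)) => //; exact: rca_zero_regular. Defined.

Definition rca_add (mu nu : rca) : rca.
Proof.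
apply: (@Rca (cadd mu nu)); first exact: rca_add_regular.
move=> A nA; rewrite -[LHS]/(mu A + nu A)%E.
by rewrite !rca_nonmeasurable// adde0.
Defined.

Definition rca_scale (a : R) (mu : rca) : rca.
Proof.
apply: (@Rca (cscale a mu)); first exact: rca_scale_regular.
move=> A nA; rewrite -[LHS]/(a%:E * mu A)%E.
by rewrite rca_nonmeasurable// mule0.
Defined.

Definition rca_opp (mu : rca) : rca := rca_scale (-1) mu.

Fact rca_addA : associative rca_add.
Proof. by move=> m n p; apply: rca_eqP => A _; exact: addeA. Qed.
Fact rca_addC : commutative rca_add.
Proof. by move=> m n; apply: rca_eqP => A _; exact: addeC. Qed.
Fact rca_add0 : left_id rca_zero rca_add.
Proof. by move=> m; apply: rca_eqP => A _; exact: add0e. Qed.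
Fact rca_addN : left_inverse rca_zero rca_opp rca_add.
Proof.
move=> m; apply: rca_eqP => A _; rewrite -[LHS]/((-1)%:E * m A + m A)%E.
by rewrite mulN1e addeC subee// rca_fin_num.
Qed.

HB.instance Definition _ :=
  GRing.isZmodule.Build rca rca_addA rca_addC rca_add0 rca_addN.

Fact rca_scaleA (a b : R) m : rca_scale a (rca_scale b m) = rca_scale (a * b) m.
Proof. by apply: rca_eqP => A _; exact: muleA. Qed.
Fact rca_scale1 : left_id 1 rca_scale.
Proof. by move=> m; apply: rca_eqP => A _; exact: mul1e. Qed.
Fact rca_scaleDr : right_distributive rca_scale +%R.
Proof.
move=> a m n; apply: rca_eqP => A _.
rewrite -[LHS]/(a%:E * (m A + n A))%E muleDr//.
by rewrite fin_num_adde_defr// rca_fin_num.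
Qed.
Fact rca_scaleDl m : {morph rca_scale^~ m : a b / a + b}.
Proof.
move=> a b; apply: rca_eqP => A _.
by rewrite -[LHS]/((a + b)%:E * m A)%E EFinD muleDl// rca_fin_num.
Qed.

HB.instance Definition _ := GRing.Zmodule_isLmodule.Build R rca
  rca_scaleA rca_scale1 rca_scaleDr rca_scaleDl.

Definition rca_norm (mu : rca) : R := total_variation mu.

Fact rca_ler_normD (mu nu : rca) :
  rca_norm (mu + nu) <= rca_norm mu + rca_norm nu.
Proof. exact: total_variation_cadd. Qed.

Fact rca_normZ_le (a : R) (mu : rca) : rca_norm (a *: mu) <= `|a| * rca_norm mu.
Proof. exact: total_variation_cscale_le. Qed.

Fact rca_norm_ge0 (mu : rca) : 0 <= rca_norm mu.
Proof.
rewrite /rca_norm -lee_fin; have := total_variation_ge mu measurable0 measurable0 (setI0 _).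
by apply: le_trans; rewrite adde_ge0.
Qed.

Fact rca_normZ (a : R) (mu : rca) : rca_norm (a *: mu) = `|a| * rca_norm mu.
Proof.
apply/eqP; rewrite eq_le rca_normZ_le/=.
have [->|a0] := eqVneq a 0; first by rewrite normr0 mul0r rca_norm_ge0.
rewrite -ler_pdivlMl ?normr_gt0// -normfV.
by have := rca_normZ_le a^-1 (a *: mu); rewrite scalerA mulVf// scale1r.
Qed.

Fact rca_norm0_eq0 (mu : rca) : rca_norm mu = 0 -> mu = 0.
Proof. by move=> mu0; apply: rca_eqP => A mA; exact: total_variation_eq0. Qed.

HB.instance Definition _ := Lmodule_isNormed.Build R rca
  rca_ler_normD rca_normZ rca_norm0_eq0.

Lemma rca_normE (mu : rca) : `|mu| = total_variation mu.
Proof. by []. Qed.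

End rca.

Section dual.
Context (R : realType) (V : normedModType R).

Record dual := Dual {
  dual_fun :> {linear V -> R^o} ;
  dual_continuous : continuous (dual_fun : V -> R^o) }.

End dual.

Section duality.
Variable R : realType.
Local Notation C01 := (C01 R).
Local Notation rca := (rca R).

Definition pairing (mu : rca) (f : C01) : R := charge_integral mu f.

Section bidual_embedding.
Variable f : C01.

Definition bidual_fun : rca -> R^o := pairing ^~ f.

Fact bidual_linear : linear bidual_fun.
Proof.
move=> a mu nu; have bf := C01_bounded_measurable f.
transitivity (charge_integral (a *: mu) f + charge_integral nu f).
  exact: charge_integral_cadd.
by congr (_ + _); exact: charge_integral_cscale.
Qed.

HB.instance Definition _ :=
  GRing.isLinear.Build R rca R^o *:%R bidual_fun bidual_linear.

Fact bidual_continuous : continuous bidual_fun.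
Proof.
apply/linear_bounded_continuous/linear_boundedP.
exists `|f|; split; first exact: num_real.
move=> M fM mu; apply: (@le_trans _ _ (`|f| * `|mu|)).
  apply: normr_charge_integral; first exact: C01_bounded_measurable.
  exact: ler_C01_norm.
by rewrite ler_wpM2r// ltW.
Qed.

Definition bidual_embedding : dual rca := Dual bidual_continuous.

End bidual_embedding.

Definition duality_mapping (f : C01) : set rca :=
  [set mu | pairing mu f = `|f| ^+ 2 /\ `|f| ^+ 2 = `|mu| ^+ 2].

Definition nonneg_cone : set C01 := [set f | forall s : I01 R, 0 <= f s].

Local Open Scope ereal_scope.

(* The limit superior is along the filter of punctured neighbourhoods
   [(f, mu)^'] of [(f, mu)] in the product of the norm topologies, restricted to
   the graph of [F]. *)
Definition mordukhovich_derivative (F : C01 -> set rca) (f : C01) (mu : rca)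
    (Phi : dual rca) : set rca :=
  [set lambda |
    limf_esup
      (fun z : C01 * rca =>
         ((pairing lambda (z.1 - f) - Phi (z.2 - mu)) /
          (`|z.1 - f| + `|z.2 - mu|))%R%:E)
      (within [set z | F z.1 z.2] (f, mu)^') <= 0].

End duality.

(* Main.v *)
Require Import Defs.
From mathcomp Require Import all_boot all_order all_algebra.
From mathcomp Require Import all_classical all_reals all_analysis.
From mathcomp Require Import lra.

Set Implicit Arguments.
Unset Strict Implicit.
Unset Printing Implicit Defensive.

Import Order.TTheory GRing.Theory Num.Theory.
Import numFieldNormedType.Exports.

Local Open Scope ring_scope.

(** The duality mapping is homogeneous, so its graph contains, along with
    [(f, mu)], all the pairs [((1 - t) f, (1 - t) mu)] ([duality_mappingZ]).  As
    [t] decreases to [0], these pairs tend to [(f, mu)] in norm while staying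
    different from it ([cvg_shrink_graph]), so the limit superior that defines
    the Mordukhovich derivative is at least any lower bound of the difference
    quotient along them ([limf_esup_ge_along]).  For [lambda = 0] and
    [Phi = f**] the quotient there is
    [t <mu, f> / (t |f| + t |mu|) = t |f|^2 / (2 t |f|) = |f| / 2], a positive
    constant: moving towards the origin lowers the pairing with [f] at a linear
    rate.  Hence the limit superior is positive. *)

(** A limit superior dominates any eventual lower bound along a subfilter;
    [h] parametrizes the subfilter, typically as a path. *)
Lemma limf_esup_ge_along (R : realType) (T : choiceType)
    (X : filteredType T) (U : Type) (u : X -> \bar R)
    (F : set_system X) (G : set_system U) (h : U -> X) (c : \bar R)
    {PG : ProperFilter G} :
  (h @ G --> F)%classic -> (\forall t \near G, c <= u (h t))%E ->
  (c <= limf_esup u F)%E.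
Proof.
move=> hGF cu; rewrite limf_esupE; apply: le_ereal_inf_tmp => _ [A FA <-].
have [t [cut At]] := filter_ex (filterI cu (hGF _ FA)).
by apply: (le_trans cut); apply: ereal_sup_ubound; exists (h t).
Qed.

Section duality_mapping.
Local Open Scope classical_set_scope.
Context (R : realType).
Implicit Types (f : C01 R) (mu : rca R).

Lemma pairing0l f : pairing 0 f = 0.
Proof. exact: (linear0 (bidual_embedding f)). Qed.

Lemma pairingZl (a : R) mu f : pairing (a *: mu) f = a * pairing mu f.
Proof. exact/charge_integral_cscale/C01_bounded_measurable. Qed.

Lemma pairingZr (a : R) mu f : pairing mu (a *: f) = a * pairing mu f.
Proof.
have bf := C01_bounded_measurable f.
rewrite /pairing /charge_integral mulrBr; congr (_ - _).
- apply: RintegralZl => //; apply: bounded_measurable_integrable bf.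
  exact: jordan_pos_lty.
- apply: RintegralZl => //; apply: bounded_measurable_integrable bf.
  exact: jordan_neg_lty.
Qed.

Lemma duality_mappingZ (a : R) f mu :
  duality_mapping f mu -> duality_mapping (a *: f) (a *: mu).
Proof.
move=> [muf fmu]; split.
- by rewrite pairingZl pairingZr muf normrZ exprMn real_normK ?num_real// mulrA.
- by rewrite !normrZ !exprMn fmu.
Qed.

Lemma duality_mapping_norm f mu : duality_mapping f mu -> `|mu| = `|f|.
Proof. by move=> [_ /eqP]; rewrite eqrXn2// => /eqP. Qed.

(** Homogeneity keeps the path on the graph of the duality mapping, and
    [f != 0] keeps it away from its end point, as the punctured neighbourhood
    filter demands. *)
Lemma cvg_shrink_graph f mu : f != 0 -> duality_mapping f mu ->
  ((1 - t) *: f, (1 - t) *: mu) @[t --> (0 : R)^'+] -->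
  within [set z | duality_mapping z.1 z.2] (f, mu)^'.
Proof.
move=> f0 Jfmu.
have shrink (V : normedModType R) (v : V) :
    ((1 - t) *: v) @[t --> (0 : R)^'+] --> v.
  rewrite -[X in _ --> X]scale1r -[1 in X in _ --> X]subr0.
  apply: cvgZr_tmp; apply: cvgB; first exact: cvg_cst.
  exact: cvg_within.
move=> A /(cvg_pair (shrink _ f) (shrink _ mu)) A'.
rewrite /nbhs/=; near=> t.
have t0 : 0 < t by near: t; exact: nbhs_right_gt.
have : [set t | ((1 - t) *: f, (1 - t) *: mu) != (f, mu) ->
  duality_mapping ((1 - t) *: f) ((1 - t) *: mu) ->
   A ((1 - t) *: f, (1 - t) *: mu)] t by near: t; exact: A'.
apply; last exact: duality_mappingZ.
apply/eqP => -[+ _] => /eqP; rewrite scalerBl scale1r subr_eq addrC -subr_eq.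
rewrite subrr eq_sym scaler_eq0 (negbTE f0) orbF => /eqP t0'.
by rewrite t0' ltxx in t0.
Unshelve. all: by end_near. Qed.

End duality_mapping.

Theorem theorem5p3 (R : realType) (f : C01 R) (hf : nonneg_cone f)
    (f_gt0 : 0 < `|f|) (mu : rca R) (hmu : duality_mapping f mu) :
  ~ mordukhovich_derivative (@duality_mapping R) f mu (bidual_embedding f) 0.
Proof.
apply/negP; rewrite -ltNge.
apply: (@lt_le_trans _ _ (`|f| / 2)%:E); first by rewrite lte_fin divr_gt0.
have f0 : f != 0 by rewrite -normr_gt0.
apply: limf_esup_ge_along (cvg_shrink_graph f0 hmu) _.
near=> t; have t0 : 0 < t by near: t; exact: nbhs_right_gt.
rewrite /= pairing0l.
have shift (V : lmodType R) (v : V) : (1 - t) *: v - v = (- t) *: v.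
  by rewrite scalerBl scale1r addrAC subrr add0r scaleNr.
rewrite !shift -[bidual_fun _ _]/(pairing _ _) pairingZl hmu.1.
rewrite !normrZ (duality_mapping_norm hmu) normrN (gtr0_norm t0) lee_fin.
rewrite ler_pdivlMr ?addr_gt0 ?mulr_gt0//.
by nra.
Unshelve. all: by end_near. Qed.
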